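(* Let $r$, $s$ and $n$ be positive integers. Any $n\times\cdots\times n$ $r$-partite graph, where each part is incident with at least $\left(r-1-\frac{1}{4s^2}\right)n^2$ edges, necessarily contains $K_r(s)$.
   Context: An $n\times\cdots\times n$ $r$-partite graph is a graph whose vertex set is partitioned into $r$ independent sets (parts), each of size exactly $n$. The number of edges incident with a part $V_i$ is the number of edges having an endpoint in $V_i$ (equivalently $\sum_{v\in V_i}d_G(v)$). $K_r(s)$ denotes the complete $r$-partite graph with exactly $s$ vertices in each part; containing it means containing it as a subgraph.
   Formalization: The hypothesis s ≤ n is added: for n < s the complete r-partite graph with parts of size n satisfies the edge condition but has only rn < rs vertices, so it cannot contain K_r(s). *)

(* Defs.v *)
From mathcomp Require Import all_boot all_order all_algebra.

Set Implicit Arguments.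
Unset Strict Implicit.
Unset Printing Implicit Defensive.

(* A finite simple graph is a symmetric irreflexive relation on a finType. *)
Definition simple_graph (T : finType) (e : rel T) : Prop :=
  symmetric e /\ irreflexive e.

Definition edges (T : finType) (e : rel T) : {set {set T}} :=
  [set [set u.1; u.2] | u in [set u : T * T | e u.1 u.2]].

(* Edges with at least one endpoint in V, each counted once. *)
Definition incident_edges (T : finType) (e : rel T) (V : {set T}) :
    {set {set T}} :=
  [set E in edges e | E :&: V != set0].

Definition independent (T : finType) (e : rel T) (V : {set T}) : Prop :=
  forall x y, x \in V -> y \in V -> ~~ e x y.

(* P is a witnessing vertex partition of an n x ... x n r-partite graph. *)
Definition balanced_multipartition (T : finType) (e : rel T) (r n : nat)
    (P : {set {set T}}) : Prop :=
  [/\ partition P [set: T], #|P| = r,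
      forall V, V \in P -> #|V| = n
    & forall V, V \in P -> independent e V].

(* K_r(s): the vertex (i, a) is the a-th vertex of the i-th part. *)
Definition complete_multipartite (r s : nat) : rel ('I_r * 'I_s) :=
  [rel u v | u.1 != v.1].

(* Not necessarily induced subgraph containment. *)
Definition contains_subgraph (T : finType) (e : rel T) (S : finType)
    (h : rel S) : Prop :=
  exists2 f : S -> T, injective f & forall x y, h x y -> e (f x) (f y).

(* Main.v *)
Require Import Defs.
From mathcomp Require Import all_boot all_order all_algebra.
From mathcomp Require Import lra.

(**
Pick an [s]-subset of every part uniformly and independently at random. By
hypothesis, for every part [V] the probabilities [p V V'] that the choices in
[V] and [V'] are not completely joined sum to at most 1/4 over the parts [V'].
Let [q I] be the probability that the choices in the parts of [I] are pairwise
completely joined. Since [q (I - j)] concerns neither [v] nor [j],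
[q (I + v) >= q I - \sum_(j in I) p v j * q (I - j)], and by induction
[q (I - j) <= 2 q I], whence [q (I + v) >= q I / 2]. So all [q I] are positive.
*)

Set Implicit Arguments.
Unset Strict Implicit.
Unset Printing Implicit Defensive.

Import Order.TTheory GRing.Theory Num.Theory.

(** * Independent choices that avoid bad pairs *)

Section PairwiseAvoidance.

Variables (R : realFieldType) (K W : finType) (D : {set K}).
Variables (Omega : K -> {set W}) (bad : rel W) (p : K -> K -> R).

Definition bad_pairs (A B : {set W}) : {set W * W} :=
  [set u in setX A B | bad u.1 u.2].

(** Counts replace probabilities: for [I] inside [D], [#|avoiding I|] is [q I] times a factor
    independent of [I], values at indices outside [D] being free. *)
Definition avoiding (I : {set K}) : {set {ffun K -> W}} :=
  [set f : {ffun K -> W} | [forall i in D, f i \in Omega i] &&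
    [forall i in I, forall j in I, (i != j) ==> ~~ bad (f i) (f j)]].

Lemma avoidingP (I : {set K}) (f : {ffun K -> W}) :
  reflect ({in D, forall i, f i \in Omega i} /\
           {in I &, forall i j, i != j -> ~~ bad (f i) (f j)})
          (f \in avoiding I).
Proof.
rewrite inE; apply: (iffP andP) => -[fO fI]; split.
- by move=> i iD; move/forall_inP: fO; apply.
- move=> i j iI jI; move/forall_inP: fI => /(_ i iI) /forall_inP /(_ j jI).
  by move/implyP.
- by apply/forall_inP.
- apply/forall_inP => i iI; apply/forall_inP => j jI; apply/implyP.
  exact: fI.
Qed.

Definition avoiding_bad (I : {set K}) (v j : K) : {set {ffun K -> W}} :=
  [set f in avoiding I | bad (f v) (f j)].

(* Independence of the coordinates [v], [j] from those in [I]: exchange the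
   values at [v] and [j] with an arbitrary pair. *)
Lemma card_avoiding_bad (I : {set K}) (v j : K) :
    v \in D -> j \in D -> v != j -> v \notin I -> j \notin I ->
  (#|avoiding_bad I v j| * (#|Omega v| * #|Omega j|) <=
   #|avoiding I| * #|bad_pairs (Omega v) (Omega j)|)%N.
Proof.
move=> vD jD vj vI jI.
pose upd (f : {ffun K -> W}) (x y : W) : {ffun K -> W} :=
  [ffun i => if i == v then x else if i == j then y else f i].
pose swap (t : {ffun K -> W} * (W * W)) :=
  (upd t.1 t.2.1 t.2.2, (t.1 v, t.1 j)).
have jv : (j == v) = false by rewrite eq_sym (negbTE vj).
have swapK : involutive swap.
  move=> [f [x y]]; rewrite /swap /=; congr (_, (_, _)).
  - apply/ffunP => i; rewrite !ffunE.
    by case: eqP => [->//|_]; case: eqP => [->|].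
  - by rewrite ffunE eqxx.
  - by rewrite ffunE jv eqxx.
(* [swap] injects the left product into the right one: the old values at [v] and [j] become the
   recorded bad pair. *)
rewrite -!cardsX -(card_imset _ (inv_inj swapK)); apply: subset_leq_card.
apply/subsetP => _ /imsetP[[f [x y]] /setXP[fB /setXP[/= xO yO]] ->].
move: fB; rewrite inE => /andP[/avoidingP[fO fI] fb].
rewrite /swap /=; apply/setXP; split; last by rewrite !inE /= !fO.
have notv i : i \in I -> (i == v) = false.
  by move=> iI; apply/negbTE/eqP => E; move: vI; rewrite -E iI.
have notj i : i \in I -> (i == j) = false.
  by move=> iI; apply/negbTE/eqP => E; move: jI; rewrite -E iI.
apply/avoidingP; split => [i iD|i k iI kI ik].
  by rewrite ffunE; case: eqP => [->//|_]; case: eqP => [->//|_]; apply: fO.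
by rewrite !ffunE !notv // !notj //; apply: fI.
Qed.

Hypothesis bad_sym : symmetric bad.
Hypothesis Omega_neq0 : forall i, i \in D -> Omega i != set0.
Hypothesis p_ge0 : forall i j, (0 <= p i j)%R.
Hypothesis bad_le : forall i j, i \in D -> j \in D -> i != j ->
  (#|bad_pairs (Omega i) (Omega j)|%:R <=
   p i j * (#|Omega i| * #|Omega j|)%:R :> R)%R.
Hypothesis p_sum : forall i, i \in D ->
  (\sum_(j in D | j != i) p i j <= 4^-1 :> R)%R.

Lemma avoiding_bad_le (I : {set K}) (v j : K) :
    v \in D -> j \in D -> v != j -> v \notin I -> j \notin I ->
  (#|avoiding_bad I v j|%:R <= p v j * #|avoiding I|%:R :> R)%R.
Proof.
move=> vD jD vj vI jI.
have N_gt0 : (0 < (#|Omega v| * #|Omega j|)%:R :> R)%R.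
  by rewrite ltr0n muln_gt0 !card_gt0 !Omega_neq0.
rewrite -(ler_pM2r N_gt0) -natrM.
apply: le_trans (_ : (#|avoiding I| * #|bad_pairs (Omega v) (Omega j)|)%:R
                     <= _)%R.
  by rewrite ler_nat card_avoiding_bad.
rewrite natrM mulrAC [leRHS]mulrC ler_wpM2l //.
exact: bad_le.
Qed.

(** If [f] fails only once [v] joins [I], some bad pair consists of [v] and an index [j] of [I].
    Dropping [j] leaves constraints that involve neither [v] nor [j], so that [avoiding_bad_le]
    applies. *)
Lemma avoiding_setU1 (I : {set K}) (v : K) :
  v \notin I ->
  avoiding I \subset
    avoiding (v |: I) :|: \bigcup_(j in I) avoiding_bad (I :\ j) v j.
Proof.
move=> vI; apply/subsetP => f fI; rewrite in_setU.
have [//|fvI] := boolP (f \in avoiding (v |: I)); apply/bigcupP.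
have /avoidingP[fO fG] := fI.
suff [j jI jb] : exists2 j, j \in I & bad (f v) (f j).
  exists j => //; rewrite inE jb andbT; apply/avoidingP; split => //.
  by move=> i k /setD1P[_ iI] /setD1P[_ kI]; apply: fG.
apply/exists_inP; apply: contraR fvI; rewrite negb_exists_in => /forall_inP H.
apply/avoidingP; split=> // i k /setU1P[->|iI] /setU1P[->|kI].
- by rewrite eqxx.
- by move=> _; apply: H.
- by move=> _; rewrite bad_sym; apply: H.
- exact: fG.
Qed.

Lemma avoiding_ratio (I : {set K}) (v : K) :
  I \subset D -> v \in D ->
  (#|avoiding I|%:R <= 2 * #|avoiding (v |: I)|%:R :> R)%R.
Proof.
have [m] := ubnP #|I|; elim: m I v => // m IH I v Im ID vD.
have [vI|vI] := boolP (v \in I).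
  by rewrite setUC (setUidPl _) ?sub1set // ler_peMl // ler1n.
have step : (#|avoiding I|%:R <= #|avoiding (v |: I)|%:R +
    \sum_(j in I) #|avoiding_bad (I :\ j) v j|%:R :> R)%R.
  rewrite -natr_sum -natrD ler_nat.
  apply: leq_trans (subset_leq_card (avoiding_setU1 vI)) _.
  apply: leq_trans (leq_card_setU _ _) _; rewrite leq_add2l.
  elim/big_rec2: _ => [|j x A _ le]; first by rewrite cards0.
  by apply: leq_trans (leq_card_setU _ _) _; rewrite leq_add2l.
have sum_le : (\sum_(j in I) #|avoiding_bad (I :\ j) v j|%:R <=
    (\sum_(j in I) p v j) * (2 * #|avoiding I|%:R) :> R)%R.
  rewrite mulr_suml; apply: ler_sum => j jI.
  have jD := subsetP ID j jI.
  have vj : v != j by apply: contraNneq vI => ->.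
  apply: le_trans (avoiding_bad_le vD jD vj _ _) _; rewrite ?inE ?eqxx //.
    by rewrite (negbTE vI) andbF.
  (* Adding [j] back to [I :\ j] gives [I], so induction with [j] as the new index bounds the count
     for [I :\ j] by twice that for [I]. *)
  rewrite ler_wpM2l // -{2}(setD1K jI); apply: IH => //.
    by move: Im; rewrite (cardsD1 j) jI.
  exact: subset_trans (subsetDl _ _) ID.
have p_le : (\sum_(j in I) p v j <= 4^-1 :> R)%R.
  apply: le_trans (p_sum vD); rewrite [leRHS](bigID (mem I)) /=.
  rewrite [X in (_ <= X + _)%R](_ : _ = \sum_(j in I) p v j)%R.
    by rewrite lerDl sumr_ge0.
  apply: eq_bigl => j; have [jI|] := boolP (j \in I); last by rewrite andbF.
  by rewrite (subsetP ID) //= andbT; apply: contraNneq vI => <-.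
(* The bad terms amount to at most 2 * 1/4 = 1/2 of [#|avoiding I|], so at least half is left for
   [avoiding (v |: I)]. *)
have := ler_wpM2r (ler0n R #|avoiding I|) p_le; lra.
Qed.

Lemma exists_avoiding (w : W) : exists f : K -> W,
  {in D, forall i, f i \in Omega i} /\
  {in D &, forall i j, i != j -> ~~ bad (f i) (f j)}.
Proof.
suff gt0 (I : {set K}) : I \subset D -> (0 < #|avoiding I|)%N.
  have /card_gt0P[f /avoidingP fP] := gt0 D (subxx _).
  by exists f.
have [m] := ubnP #|I|; elim: m I => // m IH I Im ID.
have [->|[v vI]] := set_0Vmem I.
  (* The default [w] serves indices with empty [Omega i], all of which lie outside [D]. *)
  apply/card_gt0P; exists [ffun i => odflt w [pick x in Omega i]].
  apply/avoidingP; split=> [i iD|i j]; last by rewrite inE.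
  rewrite ffunE; case: pickP => //= O0.
  by case/set0Pn: (Omega_neq0 iD) => x; rewrite O0.
have I'D : I :\ v \subset D := subset_trans (subsetDl _ _) ID.
have := avoiding_ratio I'D (subsetP ID v vI); rewrite setD1K // => le.
have : (0 < #|avoiding (I :\ v)|)%N.
  by apply: IH => //; move: Im; rewrite (cardsD1 v) vI.
rewrite -!(ltr0n R) => /lt_le_trans /(_ le).
by rewrite pmulr_rgt0 // ltr0n.
Qed.

End PairwiseAvoidance.

(** * Draws of [s]-subsets and counts of nonadjacent pairs *)

Definition draws (T : finType) (s : nat) (V : {set T}) : {set {set T}} :=
  [set S : {set T} | S \subset V & #|S| == s].

Definition not_joined (T : finType) (e : rel T) : rel {set T} :=
  fun A B => [exists a in A, exists b in B, ~~ e a b].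

Definition nonedge_pairs (T : finType) (e : rel T) (V V' : {set T}) :
    {set T * T} :=
  [set u in setX V V' | ~~ e u.1 u.2].

(** The fraction of draws containing [a] is at most s/|V|: for positive [s], removing [a] injects
    these draws into the (s-1)-subsets of [V :\ a], and [mul_bin_diag] compares the binomials. *)
Lemma card_draws_with (T : finType) (s : nat) (V : {set T}) (a : T) :
  a \in V ->
  (#|V| * #|[set S in draws s V | a \in S]| <= s * #|draws s V|)%N.
Proof.
move=> aV; rewrite cards_draws.
case: s => [|s].
  rewrite (_ : [set _ in _ | _] = set0) ?cards0 ?muln0 //.
  apply/setP => S; rewrite !inE cards_eq0.
  by case: eqP => [->|]; rewrite ?inE ?andbF.
have sub : (#|[set S in draws s.+1 V | a \in S]| <= 'C(#|V|.-1, s))%N.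
  have -> : #|V|.-1 = #|V :\ a| by rewrite (cardsD1 a V) aV.
  rewrite -cards_draws -(@card_in_imset _ _ (fun S => S :\ a)
    [set S in draws s.+1 V | a \in S]).
    apply: subset_leq_card; apply/subsetP => _ /imsetP[S + ->].
    rewrite !inE => /andP[/andP[SV Ss] aS]; rewrite setSD //=.
    by move: Ss; rewrite (cardsD1 a) aS.
  move=> S S'; rewrite !inE => /andP[_ aS] /andP[_ aS'] E.
  by rewrite -(setD1K aS) E setD1K.
by apply: leq_trans (leq_mul (leqnn _) sub) _; rewrite mul_bin_diag.
Qed.

(** Union bound over the nonadjacent pairs (a, b): the two draws contain [a] and [b] respectively
    with probability at most (s/|V|)(s/|V'|). Denominators are cleared. *)
Lemma card_bad_draws (T : finType) (e : rel T) (s : nat) (V V' : {set T}) :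
  (#|V| * #|V'| *
     #|bad_pairs (not_joined e) (draws s V) (draws s V')| <=
   s ^ 2 * #|nonedge_pairs e V V'| * (#|draws s V| * #|draws s V'|))%N.
Proof.
pose through (W : {set T}) a := [set S in draws s W | a \in S].
have cover : (#|bad_pairs (not_joined e) (draws s V) (draws s V')| <=
    \sum_(u in nonedge_pairs e V V') #|through V u.1| * #|through V' u.2|)%N.
  have sub : bad_pairs (not_joined e) (draws s V) (draws s V') \subset
      \bigcup_(u in nonedge_pairs e V V') setX (through V u.1) (through V' u.2).
    apply/subsetP => -[S S']; rewrite inE /= => /andP[/setXP[/= SV S'V]].
    case/exists_inP => a aS /exists_inP[b bS' ab].
    apply/bigcupP; exists (a, b); last first.
      by apply/setXP; split; rewrite in_set /= ?SV ?S'V.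
    move: SV S'V; rewrite !inE /= ab => /andP[SV _] /andP[S'V _].
    by rewrite (subsetP SV) // (subsetP S'V).
  apply: leq_trans (subset_leq_card sub) _.
  elim/big_rec2: _ => [|u x A _ le]; first by rewrite cards0.
  by apply: leq_trans (leq_card_setU _ _) _; rewrite cardsX leq_add2l.
apply: leq_trans (leq_mul (leqnn _) cover) _.
rewrite big_distrr /=.
apply: leq_trans (_ : \sum_(u in nonedge_pairs e V V')
    (s * #|draws s V|) * (s * #|draws s V'|) <= _)%N.
  apply: leq_sum => -[a b]; rewrite !inE /= => /andP[/andP[aV bV'] _].
  by rewrite mulnACA leq_mul // card_draws_with.
by rewrite sum_nat_const mulnACA mulnn mulnA (mulnC #|nonedge_pairs _ _ _|).
Qed.

(** Count the n * rn ordered pairs with first entry in [V]. Each incident edge yields an adjacent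
    pair; the nonadjacent pairs split by the part of their second entry, and [V] itself contributes
    n ^ 2 by independence. *)
Lemma card_incident_nonedge (T : finType) (e : rel T) (r n : nat)
    (P : {set {set T}}) (V : {set T}) :
    simple_graph e -> balanced_multipartition e r n P -> V \in P ->
  (#|incident_edges e V| +
     \sum_(V' in P | V' != V) #|nonedge_pairs e V V'| + n ^ 2 <=
   r * n ^ 2)%N.
Proof.
move=> [e_sym _] [Ppart Pr Pn Pind] VP.
have incident_le :
    (#|incident_edges e V| <= #|[set u : T * T | (u.1 \in V) && e u.1 u.2]|)%N.
  apply: leq_trans (leq_imset_card (fun u : T * T => [set u.1; u.2]) _).
  apply: subset_leq_card; apply/subsetP => E.
  rewrite inE => /andP[/imsetP[[a b]]]; rewrite inE /= => ab ->.
  case/set0Pn => x /setIP[/set2P[->|->] xV].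
    by apply/imsetP; exists (a, b); rewrite ?inE /= ?xV.
  by apply/imsetP; exists (b, a); rewrite ?inE /= ?xV 1?e_sym // setUC.
have self : #|nonedge_pairs e V V| = (n ^ 2)%N.
  rewrite -mulnn -{1}(Pn V VP) -(Pn V VP) -cardsX; apply: eq_card => -[a b].
  rewrite !inE /=; case: (boolP (a \in V)) => //= aV.
  by case: (boolP (b \in V)) => //= bV; apply: (Pind V).
have nonedges : (\sum_(V' in P | V' != V) #|nonedge_pairs e V V'| + n ^ 2)%N =
    #|[set u : T * T | (u.1 \in V) && ~~ e u.1 u.2]|.
  case/and3P: (Ppart) => /eqP Pcover Ptriv _.
  have cov (x : T) : x \in cover P by rewrite Pcover inE.
  rewrite -self addnC -(bigD1 V) //= -[RHS]sum1_card.
  rewrite (partition_big (fun u => pblock P u.2) (mem P)) /=; last first.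
    by move=> u _; rewrite pblock_mem.
  apply: eq_bigr => V' V'P; rewrite -sum1_card; apply: eq_bigl => u.
  rewrite !inE andbAC; congr (_ && _).
  apply/idP/eqP => [|<-]; last by rewrite mem_pblock.
  exact: def_pblock.
rewrite -addnA nonedges.
apply: leq_trans (leq_add incident_le (leqnn _)) _.
have cardT : #|T| = (r * n)%N.
  rewrite -cardsT (card_uniform_partition Pn Ppart) Pr //.
rewrite -mulnn mulnA -cardT mulnC -{1}(Pn V VP) -cardsT -cardsX.
rewrite -cardsUI (_ : _ :&: _ = set0) ?cards0 ?addn0.
  by apply: subset_leq_card; apply/subsetP => u; rewrite !inE;
     case: (u.1 \in V).
by apply/setP => u; rewrite !inE; case: (u.1 \in V); rewrite //= andbN.
Qed.

(** * Application to the multipartite graph *)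

Theorem corollary1p1 (r s n : nat) (hr : (0 < r)%N) (hs : (0 < s)%N)
    (hn : (0 < n)%N)
    (* K_r(n) meets the edge condition but lacks K_r(s) when n < s. *)
    (hsn : (s <= n)%N)
    (T : finType) (e : rel T) (he : simple_graph e)
    (P : {set {set T}}) (hP : balanced_multipartition e r n P)
    (hinc : forall V : {set T}, V \in P ->
       ((r%:R - 1 - (4 * s%:R ^+ 2)^-1) * n%:R ^+ 2
          <= #|incident_edges e V|%:R :> rat)%R) :
  contains_subgraph e (@complete_multipartite r s).
Proof.
have [e_sym e_irr] := he; have [Ppart Pr Pn _] := hP.
have n_gt0 : (0 < n%:R :> rat)%R by rewrite ltr0n.
have s_gt0 : (0 < s%:R :> rat)%R by rewrite ltr0n.
(* This is the bound of [card_bad_draws] for parts of size [n]. *)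
pose p (V V' : {set T}) : rat :=
  (s%:R ^+ 2 / n%:R ^+ 2 * #|nonedge_pairs e V V'|%:R)%R.
have bad_sym : symmetric (@not_joined T e).
  move=> A B; apply/exists_inP/exists_inP => -[a aA /exists_inP[b bB ab]];
  by exists b => //; apply/exists_inP; exists a => //; rewrite e_sym.
have draws_neq0 V : V \in P -> draws s V != set0.
  by move=> VP; rewrite -card_gt0 cards_draws bin_gt0 Pn.
have p_ge0 V V' : (0 <= p V V')%R.
  by rewrite mulr_ge0 // divr_ge0 // exprn_ge0 // ler0n.
have bad_le V V' : V \in P -> V' \in P -> V != V' ->
    (#|bad_pairs (@not_joined T e) (draws s V) (draws s V')|%:R <=
     p V V' * (#|draws s V| * #|draws s V'|)%:R :> rat)%R.
  move=> VP V'P _; rewrite /p [(_ / _ * _)%R]mulrAC [(_ / _ * _)%R]mulrAC.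
  rewrite ler_pdivlMr ?exprn_gt0 // -!natrX -!natrM ler_nat mulnC.
  by have := card_bad_draws e s V V'; rewrite !Pn // mulnn.
(* At most n ^ 2 / (4 s ^ 2) nonadjacent pairs lead from [V] to other parts; the factor s ^ 2 / n ^
   2 turns this into 1/4. *)
have p_sum V : V \in P -> (\sum_(V' in P | V' != V) p V V' <= 4^-1 :> rat)%R.
  move=> VP; rewrite -mulr_sumr -natr_sum.
  have := card_incident_nonedge he hP VP.
  move: (\sum_(V' in P | V' != V) _)%N => m.
  rewrite -(ler_nat rat) !natrD natrM !natrX => count.
  rewrite mulrAC ler_pdivrMr ?exprn_gt0 //.
  rewrite -ler_pdivlMl ?exprn_gt0 //.
  have := le_trans (lerD (lerD (hinc V VP) (lexx m%:R)) (lexx (n%:R ^+ 2)))%R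
    count.
  rewrite invfM; lra.
have [S [S_draw S_good]] :=
  exists_avoiding bad_sym draws_neq0 p_ge0 bad_le p_sum set0.
pose part (i : 'I_r) : {set T} := enum_val (cast_ord (esym Pr) i).
have partP i : part i \in P by apply: enum_valP.
have part_inj : injective part.
  by move=> i j /enum_val_inj /cast_ord_inj.
have S_card i : #|S (part i)| = s.
  by have := S_draw _ (partP i); rewrite inE => /andP[_ /eqP].
pose f (u : 'I_r * 'I_s) : T :=
  enum_val (cast_ord (esym (S_card u.1)) u.2).
have fS u : f u \in S (part u.1) by apply: enum_valP.
have f_edge u v : complete_multipartite u v -> e (f u) (f v).
  move=> uv; have partuv : part u.1 != part v.1 by rewrite (inj_eq part_inj).
  have := S_good _ _ (partP u.1) (partP v.1) partuv.
  rewrite negb_exists_in => /forall_inP /(_ _ (fS u)).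
  by rewrite negb_exists_in => /forall_inP /(_ _ (fS v)); rewrite negbK.
exists f => // -[i a] [j b] fE.
(* Images from distinct parts are adjacent, so a coincidence would be a loop. *)
have [ij|ij] := eqVneq i j; last first.
  have := f_edge (i, a) (j, b) ij.
  by rewrite fE e_irr.
by move: fE; rewrite /f /= -ij => /enum_val_inj /cast_ord_inj ->.
Qed.
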